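(* Let $\mathsf V$ be a pseudovariety of finite semigroups closed under concatenation. Then $\mathsf V$ is $\mu$-factorial: for every finite alphabet $X$, every factor in $\overline{\Omega}_X\mathsf V$ of an element of $\Omega^\mu_X\mathsf V$ also belongs to $\Omega^\mu_X\mathsf V$.
   Context: $\overline{\Omega}_X\mathsf V$ is the free pro-$\mathsf V$ semigroup on the finite alphabet $X$. $\widehat{\mathbb N}$ is the profinite completion of $(\mathbb N,+)$ and $x\mapsto x^\alpha$ ($\alpha\in\widehat{\mathbb N}$) the usual unary operation on profinite semigroups. $\mu$ is the implicit signature consisting of multiplication together with all unary operations $x\mapsto x^\alpha$ with $\alpha\in\widehat{\mathbb N}\setminus\mathbb N$, and $\Omega^\mu_X\mathsf V$ is the subalgebra of $\overline{\Omega}_X\mathsf V$ (for multiplication and these operations) generated by $X$. A factor of $u$ is an element $v$ with $u=xvy$ for some $x,y\in(\overline{\Omega}_X\mathsf V)^1$. A pseudovariety is closed under concatenation if the corresponding (Eilenberg) variety of rational languages is closed under concatenation product. *)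

(* Defs.v *)
From mathcomp Require Import all_boot.
Set Implicit Arguments. Unset Strict Implicit. Unset Printing Implicit Defensive.

(* ---------- finite semigroups ----------
   A finite (nonempty) semigroup is represented, up to isomorphism, by a
   multiplication table on 'I_n.+1. *)
Definition mul (n : nat) := 'I_n.+1 -> 'I_n.+1 -> 'I_n.+1.

Definition assoc_tab n (m : mul n) : Prop :=
  forall a b c, m a (m b c) = m (m a b) c.

Definition is_hom n k (m : mul n) (m' : mul k) (h : 'I_n.+1 -> 'I_k.+1) : Prop :=
  forall a b, h (m a b) = m' (h a) (h b).

Definition svar := forall n : nat, mul n -> Prop.

(* Pseudovariety: contains only semigroups, nonempty, closed under
   homomorphic images and under subdirect products (i.e. subsemigroups of
   finite direct products; this includes isomorphic copies, subsemigroups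
   and binary direct products). *)
Record pseudovariety (V : svar) : Prop := {
  pv_assoc : forall n m, V n m -> assoc_tab m;
  pv_nonempty : exists n m, V n m;
  pv_image : forall n (m : mul n) k (m' : mul k) h,
      V n m -> assoc_tab m' -> is_hom m m' h ->
      (forall b, exists a, h a = b) -> V k m';
  pv_subdirect : forall n (m : mul n) k1 (m1 : mul k1) k2 (m2 : mul k2) h1 h2,
      assoc_tab m -> V k1 m1 -> V k2 m2 -> is_hom m m1 h1 -> is_hom m m2 h2 ->
      (forall a b, h1 a = h1 b -> h2 a = h2 b -> a = b) -> V n m }.

Definition lang (X : Type) := seq X -> Prop.

Definition evalw (X : Type) n (m : mul n) (phi : X -> 'I_n.+1) (x0 : X) (w : seq X) :=
  foldl (fun s x => m s (phi x)) (phi x0) w.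

Definition V_recognizable (V : svar) (X : Type) (L : lang X) : Prop :=
  ~ L [::] /\
  exists n (m : mul n) (hV : V n m) (phi : X -> 'I_n.+1) (P : 'I_n.+1 -> Prop),
    forall x0 w, L (x0 :: w) <-> P (evalw m phi x0 w).

Definition lconcat (X : Type) (L1 L2 : lang X) : lang X :=
  fun w => exists w1 w2, w = w1 ++ w2 /\ L1 w1 /\ L2 w2.

Definition closed_under_concatenation (V : svar) : Prop :=
  forall (X : finType) (L1 L2 : lang X),
    @V_recognizable V X L1 -> @V_recognizable V X L2 ->
    @V_recognizable V X (lconcat L1 L2).

(* ---------- the free pro-V semigroup as implicit operations ----------
   Omega-bar_X V is (canonically isomorphic to) the semigroup of X-ary
   implicit operations on V: families, indexed by S in V and phi : X -> S,
   of elements of S, commuting with all homomorphisms between members of V. *)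
Definition ival (V : svar) (X : Type) :=
  forall n (m : mul n), V n m -> (X -> 'I_n.+1) -> 'I_n.+1.

Definition natural (V : svar) (X : Type) (u : ival V X) : Prop :=
  forall n (m : mul n) (hV : V n m) k (m' : mul k) (hV' : V k m') h,
    is_hom m m' h ->
    forall phi, h (u n m hV phi) = u k m' hV' (fun x => h (phi x)).

Record implop (V : svar) (X : Type) := Implop {
  iv : ival V X;
  iv_nat : natural iv }.

(* ---------- profinite exponents ----------
   hN \ N is identified with Zhat = lim Z/dZ: compatible residues. *)
Record zhat := Zhat {
  zr : nat -> nat;
  zr_compat : forall mm d, 0 < d -> 0 < mm -> d %| mm -> zr mm = zr d %[mod d] }.

(* x^k (k >= 1) in a finite semigroup *)
Definition spow n (m : mul n) (x : 'I_n.+1) (k : nat) : 'I_n.+1 :=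
  iter k.-1 (m x) x.

(* x^alpha for alpha in hN \ N: x^k for any k >= |S| with
   k = alpha mod |S|! (period of x divides |S|!) *)
Definition zexp n (a : zhat) : nat := n.+1 * (n.+1)`! + zr a ((n.+1)`!).

Definition zpow n (m : mul n) (x : 'I_n.+1) (a : zhat) : 'I_n.+1 :=
  spow m x (zexp n a).

Inductive muterm (X : Type) :=
| MVar of X
| MMul of muterm X & muterm X
| MPow of muterm X & zhat.

Fixpoint meval (X : Type) n (m : mul n) (phi : X -> 'I_n.+1) (t : muterm X) : 'I_n.+1 :=
  match t with
  | MVar x => phi x
  | MMul t1 t2 => m (meval m phi t1) (meval m phi t2)
  | MPow t1 a => zpow m (meval m phi t1) a
  end.

Definition in_OmegaMu (V : svar) (X : Type) (u : implop V X) : Prop :=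
  exists t : muterm X, forall n (m : mul n) (hV : V n m) phi,
    @iv V X u n m hV phi = meval m phi t.

Definition lmulo n (m : mul n) (o : option 'I_n.+1) (a : 'I_n.+1) :=
  if o is Some b then m b a else a.
Definition rmulo n (m : mul n) (a : 'I_n.+1) (o : option 'I_n.+1) :=
  if o is Some b then m a b else a.

Definition is_factor (V : svar) (X : Type) (v u : implop V X) : Prop :=
  exists l r : option (implop V X),
    forall n (m : mul n) (hV : V n m) phi,
      @iv V X u n m hV phi =
      lmulo m (omap (fun x => @iv V X x n m hV phi) l)
              (rmulo m (@iv V X v n m hV phi) (omap (fun y => @iv V X y n m hV phi) r)).

Definition mu_factorial (V : svar) : Prop :=
  forall (X : finType) (u v : implop V X),
    in_OmegaMu u -> is_factor v u -> in_OmegaMu v.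

(* Main.v *)
(* Closure under concatenation makes multiplication open in the free pro-V
   semigroup, so if [v] is a factor of [u] then every word close enough to [u]
   has a factor close to [v].  Approximate [u], the value of a term [t], by the
   words obtained from [t] by turning its profinite exponents into integers, and
   [v] by factors of these words.  A factor of a power [e^k] has the form
   [s e^k' p] with [s] and [p] factors of [e]; by induction on [t], along an
   ultrafilter these factors therefore converge to the value of a term, in which
   each unbounded exponent [k'] is replaced by its profinite limit. *)
From mathcomp Require Import all_boot.
From mathcomp Require Import boolp classical_sets filter.
Require Import Defs.

Set Implicit Arguments.
Unset Strict Implicit.
Unset Printing Implicit Defensive.

Local Open Scope classical_set_scope.

(** * Eventual periodicity of iterates, and values of words *)

(** The orbit enters its cycle after at most [n] steps, and the cycle length, at most [n.+1],
    divides the factorial. *)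
Lemma iter_eventually_periodic n (f : 'I_n.+1 -> 'I_n.+1) x a b :
  n <= a -> n <= b -> a = b %[mod (n.+1)`!] -> iter a f x = iter b f x.
Proof.
wlog le_ab : a b / a <= b.
  by move=> H na nb e; case/orP: (leq_total a b) => h; [|symmetry]; apply: H.
move=> na nb /eqP; rewrite eq_sym eqn_mod_dvd // => dvd_ba.
have := looping_order f x; rewrite /looping => /trajectP [q q_lt Eq].
have N_le : fingraph.order f x <= n.+1.
  by rewrite -[leqRHS]card_ord; apply: max_card.
move: (fingraph.order f x) q_lt Eq N_le => N q_lt Eq N_le.
have p_gt0 : 0 < N - q by rewrite subn_gt0.
have per : forall c, q <= c -> iter (c + (N - q)) f x = iter c f x.
  move=> c qc; rewrite -{1}(subnK qc) -addnA subnKC ?(ltnW q_lt) //.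
  by rewrite iterD Eq -iterD subnK.
have /dvdnP[c Ec] : N - q %| b - a.
  apply: dvdn_trans dvd_ba; apply: dvdn_fact.
  by rewrite p_gt0 (leq_trans (leq_subr _ _)).
rewrite -(subnKC le_ab) Ec.
have qa : q <= a by rewrite (leq_trans _ na) // -ltnS (leq_trans q_lt).
elim: c {Ec} => [|c IH]; first by rewrite mul0n addn0.
by rewrite mulSn (addnC (N - q)) addnA per ?IH // (leq_trans qa) // leq_addr.
Qed.

(* [None] plays the role of the empty word, i.e. of an adjoined identity. *)
Definition oapp2 T (op : T -> T -> T) (a b : option T) : option T :=
  match a, b with
  | Some x, Some y => Some (op x y)
  | Some x, None => Some x
  | None, _ => b
  end.

Definition word_val (X : Type) n (m : mul n) (phi : X -> 'I_n.+1) (w : seq X) :=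
  if w is x :: s then Some (evalw m phi x s) else None.

Lemma word_val_cat X n (m : mul n) (phi : X -> 'I_n.+1) w1 w2 :
  assoc_tab m ->
  word_val m phi (w1 ++ w2) = oapp2 m (word_val m phi w1) (word_val m phi w2).
Proof.
move=> mA; case: w1 w2 => [|x s] [|y t] //=; first by rewrite cats0.
congr Some; rewrite /evalw foldl_cat /=.
move: (foldl _ _ s) (phi y) => a b.
by elim: t b => [|z t IH] b //=; rewrite -IH mA.
Qed.

Lemma word_val_hom X n k (m : mul n) (m' : mul k) h (phi : X -> 'I_n.+1)
    (phi' : X -> 'I_k.+1) w :
  is_hom m m' h -> (forall x, h (phi x) = phi' x) ->
  word_val m' phi' w = omap h (word_val m phi w).
Proof.
move=> hh hphi; case: w => [|x s] //=; congr Some; rewrite /evalw -hphi.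
by elim: s (phi x) => [|y s IH] a //=; rewrite -IH hh hphi.
Qed.

Definition wpow (T : Type) (w : seq T) k := flatten (nseq k w).

Lemma word_val_pow X n (m : mul n) (phi : X -> 'I_n.+1) w a k :
  assoc_tab m -> word_val m phi w = Some a ->
  word_val m phi (wpow w k.+1) = Some (iter k (m a) a).
Proof.
move=> mA wa; elim: k => [|k IH]; first by rewrite /wpow /= cats0.
by rewrite [wpow _ _]/(w ++ wpow w k.+1) word_val_cat // wa IH.
Qed.

(** * Factors of words, of products and of powers *)

(** Levi's lemma for the free monoid. *)
Lemma cat_eq_cat T (a b c d : seq T) : a ++ b = c ++ d ->
  (exists s, c = a ++ s /\ b = s ++ d) \/ (exists s, a = c ++ s /\ d = s ++ b).
Proof.
elim: a c => [|x a IH] [|y c] //=; first by move=> ->; left; exists [::].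
- by move=> ->; left; exists (y :: c).
- by move=> <-; right; exists (x :: a).
case=> <- /IH [] [s [-> ->]]; [left|right]; by exists s.
Qed.

Definition factor T (w e : seq T) := exists a b, e = a ++ w ++ b.

Lemma prefix_factor T (w b : seq T) : factor w (w ++ b).
Proof. by exists [::], b. Qed.

Lemma suffix_factor T (a w : seq T) : factor w (a ++ w).
Proof. by exists a, [::]; rewrite cats0. Qed.

Lemma factor_refl T (w : seq T) : factor w w.
Proof. exact: (suffix_factor [::]). Qed.

Lemma factor_nil T (e : seq T) : factor [::] e.
Proof. exact: (prefix_factor [::]). Qed.

Lemma factor_cat T (w e1 e2 : seq T) : factor w (e1 ++ e2) ->
  exists w1 w2, [/\ w = w1 ++ w2, factor w1 e1 & factor w2 e2].
Proof.
case=> a [b]; case/cat_eq_cat=> [[s [_ ->]]|[s [-> /esym]]].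
  by exists [::], w; split; [| exact: factor_nil | exists s, b].
case/cat_eq_cat=> [[t [-> ->]]|[t [-> _]]].
  by exists s, t; split; [| exact: suffix_factor | exact: prefix_factor].
by exists w, [::]; split; [rewrite cats0 | exists a, t | exact: factor_nil].
Qed.

Lemma prefix_wpow T (w b e : seq T) k : w ++ b = wpow e k ->
  exists k' p, w = wpow e k' ++ p /\ factor p e.
Proof.
elim: k w => [|k IH] w.
  by case: w => // _; exists 0, [::]; split; [|exact: factor_nil].
case/cat_eq_cat=> [[s [-> _]]|[s [-> /esym/IH]]].
  by exists 0, w; split; [|exact: prefix_factor].
by case=> k' [p [-> pe]]; exists k'.+1, p; rewrite /wpow /= catA.
Qed.

(** The piece [s] ends the copy of [e] in which [w] begins; the rest is a prefix of a power. If [w]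
    stays inside that copy, [s] is [w] itself. *)
Lemma factor_wpow T (w e : seq T) k : factor w (wpow e k) ->
  exists s k' p, [/\ w = s ++ wpow e k' ++ p, factor s e & factor p e].
Proof.
have nile := factor_nil e.
elim: k w => [|k IH] w [a [b]].
  by case: a w => [|//] [] // _; exists [::], 0, [::].
case/cat_eq_cat=> [[s [_ Es]]|[s [Ee /esym]]].
  by apply: IH; exists s, b.
case/cat_eq_cat=> [[t [-> /esym/prefix_wpow]]|[t [Es _]]]; last first.
  exists w, 0, [::]; split=> //; first by rewrite !cats0.
  by exists a, t; rewrite Ee Es.
case=> k' [p [-> pe]]; exists s, k', p; split=> //.
by rewrite Ee; exact: suffix_factor.
Qed.

(** * Levels and the profinite topology *)

Lemma ord_model (F : finType) (f0 : F) :
  exists k (c : 'I_k.+1 -> F) (d : F -> 'I_k.+1), cancel c d /\ cancel d c.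
Proof.
have F_gt0 : 0 < #|F| by apply/card_gt0P; exists f0.
exists #|F|.-1, (fun i => enum_val (cast_ord (prednK F_gt0) i)),
  (fun x => cast_ord (esym (prednK F_gt0)) (enum_rank x)).
by split=> x /=; rewrite ?cast_ordKV ?enum_rankK // enum_valK cast_ordK.
Qed.

(** Members of [V] are tables on ordinals; products and subsets are transported there by a
    bijection. *)
Lemma pv_subdirect_fin (V : svar) (F : finType) (f0 : F) (op : F -> F -> F)
    k1 (m1 : mul k1) k2 (m2 : mul k2) h1 h2 :
  pseudovariety V -> V k1 m1 -> V k2 m2 -> associative op ->
  {morph h1 : x y / op x y >-> m1 x y} -> {morph h2 : x y / op x y >-> m2 x y} ->
  (forall a b, h1 a = h1 b -> h2 a = h2 b -> a = b) ->
  exists k (m : mul k) (c : 'I_k.+1 -> F) (d : F -> 'I_k.+1),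
    [/\ V k m, cancel c d, cancel d c & forall a b, c (m a b) = op (c a) (c b)].
Proof.
move=> pv V1 V2 opA hom1 hom2 inj.
have [k [c [d [cK dK]]]] := ord_model f0.
exists k, (fun a b => d (op (c a) (c b))), c, d; split=> //.
apply: (pv_subdirect pv (h1 := h1 \o c) (h2 := h2 \o c) _ V1 V2).
- by move=> x y z; rewrite !dK opA.
- by move=> x y; rewrite /= dK hom1.
- by move=> x y; rewrite /= dK hom2.
- by move=> x y /= e1 e2; apply: (can_inj cK); apply: inj.
Qed.

(* The sets of implicit operations taking a given value at a given level form
   a basis of the profinite topology. *)
Record level (V : svar) (X : Type) := Level {
  lsize : nat;
  ltab : mul lsize;
  lmem : V lsize ltab;
  lgen : X -> 'I_lsize.+1 }.

Arguments Level {V X lsize ltab}.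
Arguments ltab {V X} l.
Arguments lmem {V X} l.
Arguments lgen {V X} l.

Definition lword V X (i : level V X) (w : seq X) := word_val (ltab i) (lgen i) w.
Definition lterm V X (i : level V X) (t : muterm X) := meval (ltab i) (lgen i) t.
Definition lop V X (i : level V X) (u : implop V X) := iv u (lmem i) (lgen i).

(** Agreement at [j] then forces agreement at [i]: the neighbourhoods cut out by [j] are finer. *)
Definition refines V X (j i : level V X) := exists h,
  is_hom (ltab j) (ltab i) h /\ forall x, h (lgen j x) = lgen i x.

Lemma refines_trans V X (j i k : level V X) :
  refines k j -> refines j i -> refines k i.
Proof.
move=> [h [hh hx]] [g [gg gx]]; exists (g \o h); split=> [a b|x] /=.
  by rewrite hh gg.
by rewrite hx gx.
Qed.

Lemma refines_refl V X (i : level V X) : refines i i.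
Proof. by exists id. Qed.

Lemma lop_hom V X (j i : level V X) h (u : implop V X) :
  is_hom (ltab j) (ltab i) h -> (forall x, h (lgen j x) = lgen i x) ->
  lop i u = h (lop j u).
Proof.
move=> hh hx; rewrite /lop (iv_nat u (lmem j) (lmem i) hh).
by congr (iv u _ _); apply/funext => x; rewrite hx.
Qed.

Lemma refines_lword V X (j i : level V X) w (u : implop V X) : refines j i ->
  lword j w = Some (lop j u) -> lword i w = Some (lop i u).
Proof.
case=> h [hh hx] wu; rewrite (lop_hom u hh hx).
by rewrite /lword (word_val_hom _ hh hx) -/(lword j w) wu.
Qed.

Lemma refines_directed V X (i j : level V X) : pseudovariety V ->
  exists k, refines k i /\ refines k j.
Proof.
move=> pv.
pose F := ('I_(lsize i).+1 * 'I_(lsize j).+1)%type.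
pose op (a b : F) : F := (ltab i a.1 b.1, ltab j a.2 b.2).
have iA := pv_assoc pv (lmem i); have jA := pv_assoc pv (lmem j).
have opA : associative op by move=> a b c; rewrite /op /= iA jA.
have [||a b|k [m [c [d [Vm cK dK cM]]]]] :=
  pv_subdirect_fin (h1 := fst) (h2 := snd) (ord0, ord0) pv
    (lmem i) (lmem j) opA => //.
  by case: a b => [? ?] [? ?] /= -> ->.
exists (Level Vm (fun x => d (lgen i x, lgen j x))).
split; [exists (fst \o c) | exists (snd \o c)];
  by split=> [a b|x] /=; rewrite ?cM ?dK.
Qed.

(* The values of words form a subsemigroup belonging to V, and the components
   of an implicit operation commute with its inclusion. *)
Lemma words_dense V X (x0 : X) (i : level V X) (u : implop V X) :
  pseudovariety V -> exists w, lword i w = Some (lop i u).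
Proof.
move=> pv; have iA := pv_assoc pv (lmem i).
pose S := [pred a | `[< exists w, lword i w = Some a >]].
have S0 x : lgen i x \in S by apply/asboolP; exists [:: x].
have SM a b : a \in S -> b \in S -> ltab i a b \in S.
  move=> /asboolP[w wa] /asboolP[w' wb]; apply/asboolP; exists (w ++ w').
  by rewrite /lword word_val_cat // -!/(lword i _) wa wb.
pose F := {a | a \in S}.
pose op (a b : F) : F := Sub (ltab i (val a) (val b)) (SM _ _ (valP a) (valP b)).
pose g x : F := Sub (lgen i x) (S0 x).
have opA : associative op by move=> a b c; apply: val_inj; rewrite /= iA.
(* A subsemigroup is a subdirect product with both projections equal to the inclusion. *)
have [||a b|k [m [c [d [Vm cK dK cM]]]]] :=
  pv_subdirect_fin (h1 := val) (h2 := val) (g x0) pv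
    (lmem i) (lmem i) opA => //.
  by move=> e _; apply: val_inj.
pose j : level V X := Level Vm (d \o g).
rewrite (@lop_hom _ _ j i (val \o c) u).
- exact/asboolP/(valP (c _)).
- by move=> a b; rewrite /= cM.
- by move=> x; rewrite /= dK.
Qed.

(** * Openness of multiplication *)

Lemma mulo_natural V X (a b : implop V X) :
  natural (fun n (m : mul n) (hV : V n m) (phi : X -> 'I_n.+1) =>
             m (iv a hV phi) (iv b hV phi)).
Proof.
move=> n m hV k m' hV' h hh phi.
by rewrite hh (iv_nat a hV hV' hh) (iv_nat b hV hV' hh).
Qed.

Definition mulo V X (a b : implop V X) : implop V X := Implop (mulo_natural a b).

(* The product of the basic neighbourhoods of [a] and [b] cut out by [i] is the
   closure of a recognizable language; the level [j] recognizes it. *)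
Lemma mul_open V (X : finType) (x0 : X) (a b : implop V X) (i : level V X) :
  pseudovariety V -> closed_under_concatenation V ->
  exists2 j, refines j i & forall w, lword j w = Some (lop j (mulo a b)) ->
    exists w1 w2, [/\ w = w1 ++ w2, lword i w1 = Some (lop i a)
                    & lword i w2 = Some (lop i b)].
Proof.
move=> pv cc.
pose L (u : implop V X) : lang X := fun w => lword i w = Some (lop i u).
have Lrec u : @V_recognizable V X (L u).
  split=> //; exists (lsize i), (ltab i), (lmem i), (lgen i), (eq^~ (lop i u)).
  by move=> x w; split=> [[->]//|e]; rewrite /L /lword /= e.
have [_ [n [m [hV [phi [P PP]]]]]] := cc X _ _ (Lrec a) (Lrec b).
have [j [ji jm]] := refines_directed i (Level hV phi) pv.
exists j => // w ew.
(* By density, some product [w1 ++ w2] in the concatenation has the same value at [j] as [w]; since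
   [j] recognizes the concatenation, [w] lies in it too. *)
have [w1 e1] := words_dense x0 j a pv.
have [w2 e2] := words_dense x0 j b pv.
have e12 : lword j (w1 ++ w2) = lword j w.
  rewrite ew /lword word_val_cat; last exact: pv_assoc pv _ _ (lmem j).
  by rewrite -!/(lword j _) e1 e2.
have L12 : lconcat (L a) (L b) (w1 ++ w2).
  by exists w1, w2; split=> //; split; apply: refines_lword ji _.
suff : lconcat (L a) (L b) w by case=> v1 [v2 [-> [? ?]]]; exists v1, v2.
have [h [hh hx]] := jm.
have : word_val m phi (w1 ++ w2) = word_val m phi w.
  by rewrite !(word_val_hom _ hh hx) -!/(lword j _) e12.
move: L12 e12; case: (w1 ++ w2) => [|x s] Ls; first by rewrite ew.
by case: w ew => [//|y t] _ _ [e]; apply/PP; rewrite -e; apply/PP.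
Qed.

Lemma factor_open V (X : finType) (x0 : X) (u v : implop V X) (i : level V X) :
  pseudovariety V -> closed_under_concatenation V -> is_factor v u ->
  exists2 j, refines j i & forall w, lword j w = Some (lop j u) ->
    exists2 w', factor w' w & lword i w' = Some (lop i v).
Proof.
move=> pv cc [l [r]].
(* Stated for any [u'] because it serves both for [u], without left cofactor, and for the product
   left once [l] is split off. *)
have right_case (u' : implop V X) i' :
    (forall j : level V X,
       lop j u' = rmulo (ltab j) (lop j v) (omap (lop j) r)) ->
    exists2 j, refines j i' & forall w, lword j w = Some (lop j u') ->
      exists2 w', factor w' w & lword i' w' = Some (lop i' v).
  case: r => [r|] /= Eu'; last first.
    exists i'; first exact: refines_refl.
    by move=> w; rewrite Eu' => ew; exists w => //; exact: factor_refl.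
  have [j ji jw] := mul_open x0 v r i' pv cc.
  exists j => // w ew; have [|w1 [w2 [-> e1 _]]] := jw w; first by rewrite ew Eu'.
  by exists w1 => //; exact: prefix_factor.
case: l => [l|] /= Eu; last first.
  by apply: right_case => j; rewrite /lop Eu; case: (r).
pose u' := if r is Some r' then mulo v r' else v.
have [|j ji jw] := right_case u' i; first by rewrite /u'; case: (r).
(* The level [j] for the right part is fixed first, so that splitting off [l] leaves a word precise
   enough at [j]. *)
have [k kj kw] := mul_open x0 l u' j pv cc.
exists k; first exact: refines_trans kj ji.
move=> w ew; have [|w1 [w2 [-> _ /jw]]] := kw w.
  by rewrite ew /lop Eu /u'; case: (r).
case=> w' [a [b ->]] ew'; exists w' => //.
by exists (w1 ++ a), b; rewrite -catA.
Qed.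

(** * Limits along an ultrafilter of levels *)

Definition cone V X (i : level V X) : set (level V X) := [set j | refines j i].

(** Common refinements make the cones a filter base, which extends to an ultrafilter. *)
Lemma cone_ultrafilter V (X : Type) : pseudovariety V ->
  exists2 U : set_system (level V X), UltraFilter U & forall i, U (cone i).
Proof.
move=> pv.
pose B : set_system (level V X) := [set A | exists i, cone i `<=` A].
have [n [m hV]] := pv_nonempty pv.
pose i0 : level V X := Level hV (fun=> ord0).
have BF : ProperFilter B.
  split; first by case=> i; apply; apply: refines_refl.
  split; first by exists i0.
    move=> A A' [i iA] [j jA']; have [k [ki kj]] := refines_directed i j pv.
    exists k => l lk; split; [apply: iA|apply: jA'].
      exact: refines_trans lk ki.
    exact: refines_trans lk kj.
  by move=> A A' AA' [i iA]; exists i => l /iA/AA'.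
have [U [UU BU]] := ultraFilterLemma BF.
by exists U => // i; apply: BU; exists i.
Qed.

(** Of finitely many fibres, an ultrafilter contains one. *)
Lemma ultra_bounded_const T (U : set_system T) (f : T -> nat) d :
  UltraFilter U -> (\forall x \near U, f x < d) -> exists r, \forall x \near U, f x = r.
Proof.
move=> UU; elim: d => [|d IH] Ud; first by have [] := filter_ex Ud.
have [|Un] := in_ultra_setVsetC [set x | f x = d] UU; first by exists d.
apply: IH; apply: filterS2 Ud Un => x; rewrite ltnS leq_eqVlt.
by case/orP=> // /eqP.
Qed.

Lemma ultra_unbounded T (U : set_system T) (f : T -> nat) c :
  UltraFilter U -> ~ (exists r, \forall x \near U, f x = r) ->
  \forall x \near U, c <= f x.
Proof.
move=> UU nc; have [//|Uc] := in_ultra_setVsetC [set x | c <= f x] UU.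
case: nc; apply: (@ultra_bounded_const _ _ _ c).
by apply: filterS Uc => x /negP; rewrite -ltnNge.
Qed.

(** This is the profinite limit of [f]: each residue is constant on a set of [U], and two moduli are
    compared at a point common to both sets. *)
Lemma ultra_residues T (U : set_system T) (f : T -> nat) :
  UltraFilter U -> exists a : zhat,
    forall d, 0 < d -> \forall x \near U, f x = zr a d %[mod d].
Proof.
move=> UU.
have /choice[r rP] : forall d, exists r, 0 < d -> \forall x \near U, f x = r %[mod d].
  case=> [|d]; first by exists 0.
  have [|r Ur] := @ultra_bounded_const _ U (fun x => f x %% d.+1) d.+1 UU.
    by apply: filterE => x; rewrite ltn_mod.
  have [x xr] := filter_ex Ur.
  by exists r => _; apply: filterS Ur => y <-; rewrite modn_mod.
have rcompat mm d : 0 < d -> 0 < mm -> d %| mm -> r mm = r d %[mod d].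
  move=> d0 mm0 dm.
  have [x [xm xd]] := filter_ex (filterI (rP _ mm0) (rP _ d0)).
  by rewrite -xd -(modn_dvdm (r mm) dm) -xm modn_dvdm.
by exists (Zhat rcompat).
Qed.

(** Convergence in the free pro-[V] semigroup with an adjoined identity: [l] indexes the net, [i]
    the neighbourhoods of the limit. *)
Definition converges V X (U : set_system (level V X)) (W : level V X -> seq X)
    (o : option (muterm X)) :=
  forall i : level V X, \forall l \near U, lword i (W l) = omap (lterm i) o.

Lemma converges_cat V X (U : set_system (level V X)) W1 W2 o1 o2 :
  pseudovariety V -> UltraFilter U ->
  converges U W1 o1 -> converges U W2 o2 ->
  converges U (fun l => W1 l ++ W2 l) (oapp2 (@MMul X) o1 o2).
Proof.
move=> pv UU c1 c2 i; apply: filterS2 (c1 i) (c2 i) => l.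
rewrite {3}/lword word_val_cat; last exact: pv_assoc pv _ _ (lmem i).
by rewrite -!/(lword i _) => -> ->; case: (o1) (o2) => [?|] [?|].
Qed.

(** Powers of a base tending to the empty word do so too. Otherwise [k] is constant on a set of [U],
    which gives a finite product, or unbounded, which gives its profinite limit as exponent. *)
Lemma converges_pow V X (U : set_system (level V X)) E (k : level V X -> nat) o :
  pseudovariety V -> UltraFilter U -> converges U E o ->
  exists o', converges U (fun l => wpow (E l) (k l)) o'.
Proof.
move=> pv UU; case: o => [t|] cE; last first.
  exists None => i; apply: filterS (cE i) => l; case: (E l) => // _.
  by elim: (k l).
have iA (i : level V X) := pv_assoc pv (lmem i).
have [[[|c] Uc]|unb] := EM (exists c, \forall l \near U, k l = c).
- by exists None => i; apply: filterS Uc => l ->.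
- exists (Some (iter c (MMul t) t)) => i.
  apply: filterS2 Uc (cE i) => l -> El; rewrite /lword (word_val_pow c (iA i) El) /=.
  by congr Some; elim: c => //= c ->.
have [a aP] := ultra_residues k UU.
exists (Some (MPow t a)) => i.
apply: filterS3 (ultra_unbounded (lsize i).+1 UU unb) (aP _ (fact_gt0 (lsize i).+1)) (cE i).
move=> l; case: (k l) => // c lec ec El.
rewrite /lword (word_val_pow c (iA i) El) /=; congr Some.
rewrite /lterm /= /zpow /spow.
set N := zexp _ _.
have N_ge : (lsize i).+1 <= N.
  by rewrite /N /zexp (leq_trans _ (leq_addr _ _)) // leq_pmulr // fact_gt0.
apply: iter_eventually_periodic => //; first by rewrite -ltnS prednK // (leq_trans _ N_ge).
(* Iteration counts are exponents minus one, hence the shift; [zexp] differs from the residue of [a]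
   by a multiple of the modulus. *)
apply/eqP; rewrite -(eqn_modDr 1) !addn1 prednK ?(leq_trans _ N_ge) //.
by rewrite ec /N /zexp modnMDl.
Qed.

(** * Convergence of factors, by induction on terms *)

Definition factors_converge V X (U : set_system (level V X)) (E : level V X -> seq X) :=
  forall W, (forall l, factor (W l) (E l)) -> exists o, converges U W o.

Lemma factors_converge_letter V X (U : set_system (level V X)) (x : X) :
  UltraFilter U -> factors_converge U (fun=> [:: x]).
Proof.
move=> UU W FW.
have Wx l : W l = [::] \/ W l = [:: x].
  case: (FW l) => -[|y a] [b] /=.
    by case: (W l) => [|z [|? ?]] /=; [left | case=> <-; right |].
  by case=> _; case: a => //=; case: (W l) => //; left.
have [Un|Un] := in_ultra_setVsetC [set l | W l = [::]] UU.
  by exists None => i; apply: filterS Un => l ->.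
by exists (Some (MVar x)) => i; apply: filterS Un => l nl; case: (Wx l) => // ->.
Qed.

Lemma factors_converge_cat V X (U : set_system (level V X)) E1 E2 :
  pseudovariety V -> UltraFilter U ->
  factors_converge U E1 -> factors_converge U E2 ->
  factors_converge U (fun l => E1 l ++ E2 l).
Proof.
move=> pv UU F1 F2 W FW.
have /choice[p pP] : forall l, exists p : seq X * seq X,
    [/\ W l = p.1 ++ p.2, factor p.1 (E1 l) & factor p.2 (E2 l)].
  by move=> l; have [w1 [w2 ?]] := factor_cat (FW l); exists (w1, w2).
have [o1 c1] : exists o, converges U (fun l => (p l).1) o.
  by apply: F1 => l; case: (pP l).
have [o2 c2] : exists o, converges U (fun l => (p l).2) o.
  by apply: F2 => l; case: (pP l).
have -> : W = (fun l => (p l).1 ++ (p l).2) by apply/funext => l; case: (pP l).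
by eexists; apply: converges_cat c1 c2.
Qed.

Lemma factors_converge_pow V X (U : set_system (level V X)) E (k : level V X -> nat) :
  pseudovariety V -> UltraFilter U -> factors_converge U E ->
  factors_converge U (fun l => wpow (E l) (k l)).
Proof.
move=> pv UU FE W FW.
have /choice[p pP] : forall l, exists p : seq X * nat * seq X,
    [/\ W l = p.1.1 ++ wpow (E l) p.1.2 ++ p.2, factor p.1.1 (E l) & factor p.2 (E l)].
  by move=> l; have [s [k' [q ?]]] := factor_wpow (FW l); exists (s, k', q).
(* The base converges, being a factor of itself. *)
have [o cE] : exists o, converges U E o.
  by apply: FE => l; exact: factor_refl.
have [o1 c1] : exists o, converges U (fun l => (p l).1.1) o.
  by apply: FE => l; case: (pP l).
have [o3 c3] : exists o, converges U (fun l => (p l).2) o.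
  by apply: FE => l; case: (pP l).
have [o2 c2] := converges_pow (fun l => (p l).1.2) pv UU cE.
have -> : W = (fun l => (p l).1.1 ++ wpow (E l) (p l).1.2 ++ (p l).2).
  by apply/funext => l; case: (pP l).
by eexists; apply: converges_cat c1 (converges_cat pv UU c2 c3).
Qed.

(** The integer [zexp n a] is the one by which [zpow] evaluates in tables on [n.+1] elements, so
    there the word has exactly the value of the term. *)
Fixpoint expand X (n : nat) (t : muterm X) : seq X :=
  match t with
  | MVar x => [:: x]
  | MMul t1 t2 => expand n t1 ++ expand n t2
  | MPow t1 a => wpow (expand n t1) (zexp n a)
  end.

Lemma lword_expand V X (i : level V X) (t : muterm X) : pseudovariety V ->
  lword i (expand (lsize i) t) = Some (lterm i t).
Proof.
move=> pv; have iA := pv_assoc pv (lmem i).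
elim: t => [x|t1 IH1 t2 IH2|t IH a] //=.
  by rewrite /lword word_val_cat // -!/(lword i _) IH1 IH2.
have : 0 < zexp (lsize i) a by rewrite /zexp addn_gt0 muln_gt0 fact_gt0.
rewrite /lterm /= /zpow /spow; case: (zexp _ a) => // c _.
exact: word_val_pow.
Qed.

Lemma factors_converge_expand V X (U : set_system (level V X)) (t : muterm X)
    (k : level V X -> nat) :
  pseudovariety V -> UltraFilter U -> factors_converge U (fun l => expand (k l) t).
Proof.
move=> pv UU; elim: t => [x|t1 IH1 t2 IH2|t IH a] /=.
- exact: factors_converge_letter.
- exact: factors_converge_cat.
- exact: factors_converge_pow.
Qed.

Theorem theorem2p2 (V : svar) :
  pseudovariety V -> closed_under_concatenation V -> mu_factorial V.
Proof.
move=> pv cc X u v [t ut] vu.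
(* Every term contains a variable. *)
have x0 : X by elim: t {ut}.
have [U UU Ucone] := cone_ultrafilter X pv.
(* [p.1] is the level that [factor_open] gives for the neighbourhood of [v] cut out by [l]; the
   expansion at its size has the value of [u] there. *)
have /choice[p pP] : forall l : level V X, exists p : level V X * seq X,
    factor p.2 (expand (lsize p.1) t) /\ lword l p.2 = Some (lop l v).
  move=> l; have [j _ jw] := factor_open x0 l pv cc vu.
  have [|w fw ew] := jw (expand (lsize j) t); last by exists (j, w).
  by rewrite lword_expand // /lop ut.
have [o co] : exists o, converges U (fun l => (p l).2) o.
  have F := @factors_converge_expand _ _ U t (fun l => lsize (p l).1) pv UU.
  by apply: F => l; case: (pP l).
(* Almost every [l] refines [i], so the factor chosen at [l] has the value of [v] at [i] as well. *)
have val_o (i : level V X) : Some (lop i v) = omap (lterm i) o.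
  have [l [li <-]] := filter_ex (filterI (Ucone i) (co i)).
  by symmetry; case: (pP l) => _; apply: refines_lword.
(* The limit is not the empty word, because [v] has a value at some level. *)
have [n [m hV]] := pv_nonempty pv.
case: o co val_o => [s|] _ val_o; last by have := val_o (Level hV (fun=> ord0)).
by exists s => k m' hV' phi; have [] := val_o (Level hV' phi).
Qed.
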